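(* Let $U\to X\to (Y,Z)$ be a Markov chain over finite alphabets $\mathcal U,\mathcal X,\mathcal Y,\mathcal Z$, with $P_X,P_Y,P_Z$ having all entries positive, and suppose that for all $u\in\mathcal U$ and all $\epsilon>0$ under consideration the conditional distributions are of the form $P_{X|U=u}=P_X+\epsilon J_u$ and satisfy $P_{X|U=u}\in\mathcal N_\epsilon^{\mathcal X}(P_X)$, where the perturbation vectors $J_u\in\mathbb R^{|\mathcal X|}$ satisfy $\sum_{x\in\mathcal X}J_u(x)=0$ for all $u\in\mathcal U$ and $\sum_{u\in\mathcal U}P_U(u)J_u=0$. Let $L_u=[\sqrt{P_X}]^{-1}J_u\in\mathbb R^{|\mathcal X|}$. Then, as $\epsilon\to0$, $$I(U;X)=\frac{\epsilon^2}{2}\sum_{u\in\mathcal U}P_U(u)\,\|L_u\|^2+o(\epsilon^2),$$ $$I(U;Y)=\frac{\epsilon^2}{2}\sum_{u\in\mathcal U}P_U(u)\,\|B_{Y|X}L_u\|^2+o(\epsilon^2),$$ $$I(U;Z)=\frac{\epsilon^2}{2}\sum_{u\in\mathcal U}P_U(u)\,\|B_{Z|X}L_u\|^2+o(\epsilon^2).$$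
   Context: $P_U$ is a probability distribution on $\mathcal U$, $P_X$ a probability vector on $\mathcal X$ with all entries positive, and the vectors $J_u$ are fixed while $\epsilon$ ranges over small positive values for which $P_X+\epsilon J_u$ has positive entries for every $u$. The channels $P_{Y|X}$ and $P_{Z|X}$ are fixed column-stochastic matrices of sizes $|\mathcal Y|\times|\mathcal X|$ and $|\mathcal Z|\times|\mathcal X|$, with $P_Y=P_{Y|X}P_X$ and $P_Z=P_{Z|X}P_X$. Note that the marginal of $X$ is $P_X$ for every $\epsilon$ because $\sum_uP_U(u)J_u=0$. The $\epsilon$-region of $P_X$ is $$\mathcal N_\epsilon^{\mathcal X}(P_X)=\Big\{P'_X\in\mathcal P(\mathcal X):\ \sum_{x\in\mathcal X}\frac{(P'_X(x)-P_X(x))^2}{P_X(x)}\le\epsilon^2\Big\},$$ where $\mathcal P(\mathcal X)$ is the set of probability distributions on $\mathcal X$. For a probability vector $P$ with positive entries, $[\sqrt P]$ is the diagonal matrix with entries $\sqrt{P(x)}$ and $[\sqrt P]^{-1}$ its inverse. The divergence transfer matrices are $B_{Y|X}=[\sqrt{P_Y}]^{-1}P_{Y|X}[\sqrt{P_X}]$ and $B_{Z|X}=[\sqrt{P_Z}]^{-1}P_{Z|X}[\sqrt{P_X}]$. $\|\cdot\|$ is the Euclidean norm. Mutual information is $I(U;X)=\sum_uP_U(u)D(P_{X|U=u}\|P_X)$ (similarly for $Y$ and $Z$), with $D(P\|Q)=\sum_xP(x)\log\frac{P(x)}{Q(x)}$ and natural logarithm. $o(\epsilon^2)$ denotes a quantity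 whose ratio to $\epsilon^2$ tends to $0$ as $\epsilon\to0$. *)

(* Defs.v *)
From HB Require Import structures.
From mathcomp Require Import all_boot all_order all_algebra.
From mathcomp Require Import all_classical all_reals all_analysis.

Set Implicit Arguments.
Unset Strict Implicit.
Unset Printing Implicit Defensive.

Import Order.TTheory GRing.Theory Num.Theory.
Import numFieldNormedType.Exports.

Local Open Scope classical_set_scope.
Local Open Scope ring_scope.

(* Alphabets of sizes n are 'I_n; distributions on them are column vectors. *)

Definition is_dist (R : realType) (n : nat) (P : 'cV[R]_n) : Prop :=
  (forall i, 0 <= P i 0) /\ \sum_i P i 0 = 1.

Definition positive_entries (R : realType) (n : nat) (P : 'cV[R]_n) : Prop :=
  forall i, 0 < P i 0.

(* W y x is the probability of output y given input x. *)
Definition column_stochastic (R : realType) (m n : nat) (W : 'M[R]_(m, n)) :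
    Prop :=
  forall x, is_dist (col x W).

Definition eps_region (R : realType) (n : nat) (e : R) (P : 'cV[R]_n) :
    set 'cV[R]_n :=
  [set P' | is_dist P' /\ \sum_x (P' x 0 - P x 0) ^+ 2 / P x 0 <= e ^+ 2].

Definition sqrt_diag (R : realType) (n : nat) (P : 'cV[R]_n) : 'M[R]_n :=
  diag_mx (\row_x Num.sqrt (P x 0)).

(* Divergence transfer matrix of the channel W with input distribution P; the
   output distribution is W *m P. *)
Definition dtm (R : realType) (m n : nat) (W : 'M[R]_(m, n)) (P : 'cV[R]_n) :
    'M[R]_(m, n) :=
  invmx (sqrt_diag (W *m P)) *m W *m sqrt_diag P.

(* The norm `|v| of the library on matrices is the sup norm. *)
Definition enorm (R : realType) (n : nat) (v : 'cV[R]_n) : R :=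
  Num.sqrt (\sum_i v i 0 ^+ 2).

(* [ln 0 = 0], so a term with P x = 0 contributes 0, as usual.  The value is the
   relative entropy only if Q x = 0 implies P x = 0. *)
Definition kl_div (R : realType) (n : nat) (P Q : 'cV[R]_n) : R :=
  \sum_x P x 0 * ln (P x 0 / Q x 0).

(* A joint distribution of random variables is a probability mass function p on
   a finite sample space Om on which the variables are functions. *)

Definition is_pmf (R : realType) (Om : finType) (p : Om -> R) : Prop :=
  (forall w, 0 <= p w) /\ \sum_w p w = 1.

Definition pr (R : realType) (Om : finType) (p : Om -> R) (A : pred Om) : R :=
  \sum_(w | A w) p w.

(* Meaningful only if [pr p B != 0]; it is 0 otherwise. *)
Definition cpr (R : realType) (Om : finType) (p : Om -> R) (A B : pred Om) : R :=
  pr p [pred w | A w && B w] / pr p B.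

Definition law (R : realType) (Om : finType) (p : Om -> R) (n : nat)
    (X : Om -> 'I_n) : 'cV[R]_n :=
  \col_x pr p [pred w | X w == x].

(* Column u is the conditional law of X given V = u. *)
Definition cond_law (R : realType) (Om : finType) (p : Om -> R) (m n : nat)
    (X : Om -> 'I_m) (V : Om -> 'I_n) : 'M[R]_(m, n) :=
  \matrix_(x, u) cpr p [pred w | X w == x] [pred w | V w == u].

Definition markov_chain (R : realType) (Om : finType) (p : Om -> R)
    (S T V : eqType) (A : Om -> S) (B : Om -> T) (C : Om -> V) : Prop :=
  forall a b c, 0 < pr p [pred w | (A w == a) && (B w == b)] ->
    cpr p [pred w | C w == c] [pred w | (A w == a) && (B w == b)] =
    cpr p [pred w | C w == c] [pred w | B w == b].

(* Values u with P(V = u) = 0 contribute 0. *)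
Definition mutual_info (R : realType) (Om : finType) (p : Om -> R) (m n : nat)
    (V : Om -> 'I_m) (X : Om -> 'I_n) : R :=
  \sum_u law p V u 0 * kl_div (col u (cond_law p X V)) (law p X).

(* Main.v *)
(* Expanding [x ln x] at 1 to second order, each term of D(Q + e K || Q) is
   e K(x) + e^2 K(x)^2 / (2 Q(x)) up to O(e^3); the linear terms cancel because
   K sums to 0. Since the J_u average to 0, the marginal of X does not depend on
   e, so averaging this expansion over U gives I(U;X). By the Markov property
   the laws of Y given U = u are again linear perturbations, P_Y + e W J_u, so
   the same expansion applies to them, and B L_u is W J_u rescaled by
   P_Y^(-1/2). *)
Require Import Defs.
From HB Require Import structures.
From mathcomp Require Import all_boot all_order all_algebra ring lra.
From mathcomp Require Import all_classical all_reals all_analysis.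

Set Implicit Arguments.
Unset Strict Implicit.
Unset Printing Implicit Defensive.

Import Order.TTheory GRing.Theory Num.Theory.
Import numFieldNormedType.Exports.

Local Open Scope classical_set_scope.
Local Open Scope ring_scope.

(** * Estimates of the logarithm near 1 *)

(** The inequality [ln x <= x - 1], used at [x] and at [x^-1], traps [ln x] between [1 - x^-1] and
    [x - 1]. The gap is [(x - 1) ^+ 2 / x], and [x^-1 <= 2]. *)
Lemma ln_sub_tangent_bound (R : realType) (x : R) : 2^-1 <= x ->
  `|ln x - (x - 1)| <= 2 * (x - 1) ^+ 2.
Proof.
move=> hx; have x0 : 0 < x by lra.
have Vx : x^-1 <= 2 by rewrite invf_ple ?posrE//; lra.
have up : ln x <= x - 1 by have := @le_ln1Dx R (x - 1); rewrite subrKC; apply; lra.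
have lo : - ln x <= x^-1 - 1.
  rewrite -lnV ?posrE//; have := @le_ln1Dx R (x^-1 - 1); rewrite subrKC; apply.
  by rewrite ltrBrDr addNr invr_gt0.
rewrite ler0_norm ?subr_le0//.
apply: (@le_trans _ _ ((x - 1) ^+ 2 * x^-1)); last first.
  by rewrite mulrC ler_wpM2r// sqr_ge0.
have -> : (x - 1) ^+ 2 * x^-1 = x - 1 + (x^-1 - 1) by field; lra.
lra.
Qed.

(** The error vanishes at 1 and has derivative [ln s - (s - 1)], which is quadratically small; the
    mean value theorem supplies the third factor. *)
Lemma xlnx_taylor (R : realType) (x : R) : `|x - 1| <= 2^-1 ->
  `|x * ln x - (x - 1) - (x - 1) ^+ 2 / 2| <= 2 * `|x - 1| ^+ 3.
Proof.
move=> hx.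
pose f (s : R) := s * ln s - (s - 1) - (s - 1) ^+ 2 / 2.
have df (s : R) : 0 < s -> is_derive s 1 f (ln s - (s - 1)).
  move=> s0; have ? := is_derive1_ln s0.
  apply: is_derive_eq.
  rewrite /GRing.scale /=; field; lra.
have f1 : f 1 = 0 by rewrite /f ln1 mulr0 subrr expr0n/= mul0r !subr0.
(* Serves both sides of 1: [x] will be one of [a], [b], and 1 the other. *)
have bound (a b : R) : 2^-1 <= a -> a <= 1 <= b -> b - a = `|x - 1| ->
    `|f b - f a| <= 2 * `|x - 1| ^+ 3.
  move=> ha /andP[a1 b1] eba.
  have [|s||c] := @MVT_segment R f (fun s => ln s - (s - 1)) a b.
  - lra.
  - by rewrite in_itv /= => /andP[as_ _]; apply: df; lra.
  - apply: derivable_within_continuous => s; rewrite in_itv /= => /andP[as_ _].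
    by apply: ex_derive; apply: df; lra.
  rewrite in_itv /= => /andP[ac cb] ->.
  rewrite normrM eba normr_id [_ ^+ 3]exprSr mulrA ler_wpM2r//.
  apply: le_trans (ln_sub_tangent_bound _) _; first lra.
  (* Both [c] and 1 lie between [a] and [b], at distance [b - a] from each other. *)
  rewrite ler_wpM2l// -(real_normK (num_real (c - 1))) lerXn2r ?nnegrE//.
  by rewrite -eba ler_norml; lra.
have := hx; rewrite ler_norml => /andP[x1 x2].
have [x_le1|/ltW x_ge1] := leP x 1.
  have := bound x 1; rewrite f1 sub0r normrN; apply; [lra|lra|].
  by rewrite ler0_norm; lra.
have := bound 1 x; rewrite f1 subr0; apply; [lra|lra|].
by rewrite ger0_norm; lra.
Qed.

(** * Little-o calculus and expansion of the divergence *)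

Lemma sum_eqaddo (R : realType) (I : finType) (F : filter_on R)
    (w : I -> R) (f g : I -> R -> R) (h : R -> R) :
  (forall i, f i = g i +o_F h) ->
  (fun e => \sum_i w i * f i e) = (fun e => \sum_i w i * g i e) +o_F h.
Proof.
move=> fg; apply/eqaddoP.
have -> : (fun e => \sum_i w i * f i e) - (fun e => \sum_i w i * g i e) =
    \sum_i w i *: (f i - g i).
  apply/funext => e; rewrite fct_sumE !fctE -sumrB; apply: eq_bigr => i _.
  by rewrite -mulrBr.
(* Functions that are little-o of [h] form a linear space, so induction on the sum suffices. *)
apply/eqoP; elim/big_ind: _ => [|u v uo vo|i _].
- by apply/eqoP => eps eps0; near=> e; rewrite normr0 mulr_ge0// ltW.
- by rewrite uo vo addo.
- have /eqaddoP/eqoP -> := fg i; exact: scaleo.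
Unshelve. all: by end_near. Qed.

Lemma eqaddo_sqrP (R : realType) (f g : R -> R) :
  f = g +o_ (0^'+) (fun e : R => e ^+ 2) <->
  (forall eps, 0 < eps -> \forall e \near 0^'+, `|f e - g e| <= eps * e ^+ 2).
Proof.
have sqrE (e : R) : `|(e ^+ 2 : R^o)| = e ^+ 2 by apply: ger0_norm; exact: sqr_ge0.
split=> [/eqaddoP fg eps eps0|fg]; last apply/eqaddoP => eps eps0.
- by have := fg eps eps0; apply: filterS => e; rewrite !fctE sqrE.
- by have := fg eps eps0; apply: filterS => e; rewrite !fctE sqrE.
Qed.

(** This is [q] times the expansion of [x ln x] at [x = 1 + e k / q]; the remainder is at most
    [2 e^3 |k|^3 / q^2]. *)
Lemma xlnx_perturbation (R : realType) (q k : R) : 0 < q ->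
  (fun e : R => (q + e * k) * ln ((q + e * k) / q)) =
  (fun e : R => e * k + e ^+ 2 / 2 * (k ^+ 2 / q))
    +o_ (0^'+) (fun e : R => e ^+ 2).
Proof.
move=> q0; apply/eqaddo_sqrP => eps eps0.
(* The remainder constant plus 1, which stays a valid divisor when [k = 0]. *)
have C0 : 0 < 1 + 2 * `|k| ^+ 3 / q ^+ 2.
  by rewrite ltr_pwDl// divr_ge0 ?mulr_ge0 ?exprn_ge0// ltW.
have k0 : 0 < 1 + `|k| by rewrite ltr_pwDl.
near=> e.
have e0 : 0 < e by near: e; exact: nbhs_right_gt.
(* Keeps [(q + e * k) / q] within 1/2 of 1, the range of [xlnx_taylor]. *)
have eq : e <= q / (2 * (1 + `|k|)).
  by near: e; apply: nbhs_right_le; rewrite divr_gt0// mulr_gt0.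
have eC : e <= eps / (1 + 2 * `|k| ^+ 3 / q ^+ 2).
  by near: e; apply: nbhs_right_le; rewrite divr_gt0.
have xE : (q + e * k) / q - 1 = e * k / q by field; lra.
have := @xlnx_taylor R ((q + e * k) / q).
rewrite xE !normrM normfV (gtr0_norm e0) (gtr0_norm q0) => bound.
set l := ln _ in bound *.
have -> : (q + e * k) * l - (e * k + e ^+ 2 / 2 * (k ^+ 2 / q)) =
    q * ((q + e * k) / q * l - e * k / q - (e * k / q) ^+ 2 / 2).
  by field; lra.
rewrite normrM (gtr0_norm q0).
have {}bound : `|(q + e * k) / q * l - e * k / q - (e * k / q) ^+ 2 / 2| <=
    2 * (e * `|k| / q) ^+ 3.
  apply: bound; rewrite ler_pdivrMr// mulrC.
  move: eq; rewrite ler_pdivlMr ?mulr_gt0// => eq; lra.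
apply: (@le_trans _ _ (q * (2 * (e * `|k| / q) ^+ 3))); first by rewrite ler_pM2l.
have -> : q * (2 * (e * `|k| / q) ^+ 3) =
    e * (2 * `|k| ^+ 3 / q ^+ 2) * e ^+ 2 by field; lra.
rewrite ler_pM2r ?exprn_gt0//.
by move: eC; rewrite ler_pdivlMr// mulrDr mulr1; lra.
Unshelve. all: by end_near. Qed.

Lemma kl_div_perturbation (R : realType) (n : nat) (Q K : 'cV[R]_n) :
  positive_entries Q -> \sum_x K x 0 = 0 ->
  (fun e : R => kl_div (Q + e *: K) Q) =
  (fun e : R => e ^+ 2 / 2 * \sum_x K x 0 ^+ 2 / Q x 0)
    +o_ (0^'+) (fun e : R => e ^+ 2).
Proof.
move=> Q0 K0.
(* The weights 1 give both sides the shape of [sum_eqaddo]. *)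
have -> : (fun e : R => kl_div (Q + e *: K) Q) =
    (fun e => \sum_x 1 * ((Q x 0 + e * K x 0) * ln ((Q x 0 + e * K x 0) / Q x 0))).
  by apply/funext => e; apply: eq_bigr => x _; rewrite mul1r !mxE.
have -> : (fun e : R => e ^+ 2 / 2 * \sum_x K x 0 ^+ 2 / Q x 0) =
    (fun e => \sum_x 1 * (e * K x 0 + e ^+ 2 / 2 * (K x 0 ^+ 2 / Q x 0))).
  apply/funext => e; under [RHS]eq_bigr do rewrite mul1r.
  by rewrite big_split/= -!mulr_sumr K0 mulr0 add0r.
by apply: sum_eqaddo => x; exact: xlnx_perturbation.
Qed.

(** * Conditional laws and Markov chains *)

Section Probability.
Context (R : realType) (Om : finType) (p : Om -> R) (p_ge0 : forall w, 0 <= p w).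

Lemma pr_ge0 (A : pred Om) : 0 <= pr p A.
Proof. by apply: sumr_ge0. Qed.

Lemma pr_total (T : finType) (C : Om -> T) (A : pred Om) :
  pr p A = \sum_t pr p [pred w | (C w == t) && A w].
Proof.
rewrite /pr (partition_big C predT) //=.
by apply: eq_bigr => t _; apply: eq_bigl => w; rewrite andbC.
Qed.

(** If [pr p B] is 0, the right side vanishes and the left side is squeezed between 0 and
    [pr p B]. *)
Lemma pr_condE (A B : pred Om) :
  pr p [pred w | A w && B w] = cpr p A B * pr p B.
Proof.
rewrite /cpr; have [B0|B0] := eqVneq (pr p B) 0; last by rewrite divfK.
rewrite B0 mulr0; apply/eqP; rewrite eq_le pr_ge0 andbT -B0.
rewrite /pr [leRHS](bigID A) /= ler_wpDr ?sumr_ge0//.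
by rewrite le_eqVlt; apply/orP; left; apply/eqP/eq_bigl => w; rewrite andbC.
Qed.

Lemma law_total (m n : nat) (X : Om -> 'I_m) (V : Om -> 'I_n) :
  law p X = cond_law p X V *m law p V.
Proof.
apply/matrixP => x j; rewrite !mxE (pr_total V); apply: eq_bigr => v _.
rewrite !mxE -pr_condE /pr; apply: eq_bigl => w /=; exact: andbC.
Qed.

(** Conditional probabilities add up over the fibres of [g]. With [g] a projection, a chain ending
    in a pair yields one for each component. *)
Lemma markov_chain_comp (S T V W : finType) (A : Om -> S) (B : Om -> T)
    (C : Om -> V) (g : V -> W) :
  markov_chain p A B C -> markov_chain p A B (g \o C).
Proof.
have cpr_comp (D : pred Om) c : cpr p [pred w | (g \o C) w == c] D =
    \sum_(v | g v == c) cpr p [pred w | C w == v] D.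
  rewrite /cpr -mulr_suml; congr (_ / _).
  rewrite /pr (partition_big C (fun v => g v == c)) /=; last first.
    by move=> w /andP[].
  apply: eq_bigr => v /eqP <-; apply: eq_bigl => w.
  rewrite andbC andbA; case: eqP => //= ->; by rewrite eqxx.
move=> h a b c ab; rewrite !cpr_comp; apply: eq_bigr => v _; exact: h.
Qed.

(** Split over the values of [X], then drop the condition on [V] by the Markov property. Both sides
    carry the same denominator P(V = v), so a null [v] is covered too. *)
Lemma cond_law_markov (l m n : nat) (V : Om -> 'I_l) (X : Om -> 'I_m)
    (Y : Om -> 'I_n) (v : 'I_l) : markov_chain p V X Y ->
  col v (cond_law p Y V) = cond_law p Y X *m col v (cond_law p X V).
Proof.
move=> h; apply/matrixP => y j; rewrite !mxE.
rewrite {1}/cpr (pr_total X) mulr_suml; apply: eq_bigr => x _.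
rewrite !mxE {2}/cpr mulrA; congr (_ / _).
pose VX := [pred w | (V w == v) && (X w == x)].
transitivity (pr p [pred w | (Y w == y) && VX w]).
  by apply: eq_bigl => w /=; do 3 case: eqP.
transitivity (cpr p [pred w | Y w == y] [pred w | X w == x] * pr p VX).
  (* The Markov property speaks only of conditions of positive probability; on a null one both
     products are 0. *)
  rewrite pr_condE; have [VX0|] := eqVneq (pr p VX) 0; first by rewrite VX0 !mulr0.
  by move=> VX0; rewrite h// lt_def VX0 pr_ge0.
by congr (_ * _); apply: eq_bigl => w /=; exact: andbC.
Qed.

End Probability.

(** * Rescaling by square roots and the divergence transfer matrix *)

Lemma sqrt_diag_unit (R : realType) (n : nat) (P : 'cV[R]_n) :
  positive_entries P -> sqrt_diag P \in unitmx.
Proof.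
move=> P0; rewrite unitmxE /sqrt_diag det_diag unitfE.
by apply/prodf_neq0 => i _; rewrite mxE gt_eqF// sqrtr_gt0.
Qed.

Lemma invmx_sqrt_diag_mul (R : realType) (m n : nat) (P : 'cV[R]_n)
    (A : 'M[R]_(n, m)) : positive_entries P ->
  invmx (sqrt_diag P) *m A = \matrix_(i, j) (A i j / Num.sqrt (P i 0)).
Proof.
move=> P0.
(* Factoring out [sqrt_diag P] avoids computing the entries of its inverse. *)
have eA : A = sqrt_diag P *m \matrix_(i, j) (A i j / Num.sqrt (P i 0)).
  apply/matrixP => i j; rewrite mul_diag_mx !mxE mulrC divfK //.
  by rewrite gt_eqF// sqrtr_gt0.
by rewrite [in LHS]eA mulKmx// sqrt_diag_unit.
Qed.

(** Identifies the second-order coefficient of the divergence as a squared Euclidean norm. *)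
Lemma enorm_invmx_sqrt_diag (R : realType) (n : nat) (P v : 'cV[R]_n) :
  positive_entries P ->
  enorm (invmx (sqrt_diag P) *m v) ^+ 2 = \sum_i v i 0 ^+ 2 / P i 0.
Proof.
move=> P0; rewrite /enorm sqr_sqrtr ?sumr_ge0// => [|i _]; last exact: sqr_ge0.
apply: eq_bigr => i _.
by rewrite invmx_sqrt_diag_mul// mxE expr_div_n sqr_sqrtr// ltW.
Qed.

Lemma dtm_mul (R : realType) (m n : nat) (W : 'M[R]_(m, n)) (P v : 'cV[R]_n) :
  positive_entries P ->
  dtm W P *m (invmx (sqrt_diag P) *m v) = invmx (sqrt_diag (W *m P)) *m (W *m v).
Proof.
move=> P0; rewrite /dtm -!mulmxA; congr (_ *m (_ *m _)).
exact/mulKVmx/sqrt_diag_unit.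
Qed.


(** * Expansion of mutual information *)

(** General [Q] and [K] let the same expansion serve the input [X] and the channel outputs. The
    conditional laws are prescribed only where [P v 0 > 0], since [cond_law] has a zero column at a
    null value. *)
Lemma mutual_info_perturbation (R : realType) (Om : finType) (m n : nat)
    (p : R -> Om -> R) (V : Om -> 'I_m) (X : Om -> 'I_n)
    (P : 'cV[R]_m) (Q : 'cV[R]_n) (K : 'I_m -> 'cV[R]_n) (e0 : R) :
  0 < e0 -> is_dist P -> positive_entries Q ->
  (forall v, \sum_x K v x 0 = 0) -> \sum_v P v 0 *: K v = 0 ->
  (forall e, 0 < e < e0 -> law (p e) V = P) ->
  (forall e, 0 < e < e0 -> is_pmf (p e)) ->
  (forall e, 0 < e < e0 -> forall v, 0 < P v 0 ->
     col v (cond_law (p e) X V) = Q + e *: K v) ->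
  (fun e => mutual_info (p e) V X) =
  (fun e => e ^+ 2 / 2 * \sum_v P v 0 * \sum_x K v x 0 ^+ 2 / Q x 0)
    +o_ (0^'+) (fun e : R => e ^+ 2).
Proof.
move=> e0_gt0 [P0 P1] Q0 K0 PK lawV hp condX.
have := @sum_eqaddo R _ _ (fun v => P v 0) _ _ _
  (fun v => kl_div_perturbation Q0 (K0 v)).
move=> /eqaddo_sqrP main; apply/eqaddo_sqrP => eps eps0.
have {}main := main eps eps0.
near=> e.
have e_in : 0 < e < e0.
  by apply/andP; split; near: e; [exact: nbhs_right_gt|exact: nbhs_right_lt].
have lawX : law (p e) X = Q.
  apply/matrixP => x j; rewrite (law_total (hp e e_in).1 X V) lawV// ord1.
  transitivity ((\sum_v P v 0 *: (Q + e *: K v)) x 0).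
    rewrite summxE mxE; apply: eq_bigr => v _; rewrite mxE mulrC.
    (* At a null [v] the two columns may differ, but their weight is 0. *)
    have [->|Pv0] := eqVneq (P v 0) 0; first by rewrite scale0r mxE mul0r.
    by rewrite -(condX e e_in) ?lt_def ?Pv0 ?P0// !mxE.
  under eq_bigr do rewrite scalerDr scalerA mulrC -scalerA.
  by rewrite big_split /= -scaler_suml P1 scale1r -scaler_sumr PK scaler0 addr0.
(* Equality for [e] between 0 and [e0] is enough, the little-o being local at 0. *)
suff eq : mutual_info (p e) V X = \sum_v P v 0 * kl_div (Q + e *: K v) Q.
  have : `|(\sum_v P v 0 * kl_div (Q + e *: K v) Q) -
     \sum_v P v 0 * (e ^+ 2 / 2 * \sum_x K v x 0 ^+ 2 / Q x 0)| <= eps * e ^+ 2.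
    by near: e; exact: main.
  rewrite eq mulr_sumr; congr (`|_ - _| <= _).
  by apply: eq_bigr => v _; rewrite mulrCA.
rewrite /mutual_info lawV// lawX; apply: eq_bigr => v _.
have [->|Pv0] := eqVneq (P v 0) 0; first by rewrite !mul0r.
by rewrite (condX e e_in)// lt_def Pv0 P0.
Unshelve. all: by end_near. Qed.

Lemma mutual_info_perturbation_channel (R : realType) (Om : finType)
    (l m n : nat) (p : R -> Om -> R) (V : Om -> 'I_l) (X : Om -> 'I_m)
    (Y : Om -> 'I_n) (P : 'cV[R]_l) (Q : 'cV[R]_m) (W : 'M[R]_(n, m))
    (K : 'I_l -> 'cV[R]_m) (e0 : R) :
  0 < e0 -> is_dist P ->
  positive_entries Q -> positive_entries (W *m Q) -> column_stochastic W ->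
  (forall v, \sum_x K v x 0 = 0) -> \sum_v P v 0 *: K v = 0 ->
  (forall e, 0 < e < e0 -> law (p e) V = P) ->
  (forall e, 0 < e < e0 -> is_pmf (p e)) ->
  (forall e, 0 < e < e0 -> markov_chain (p e) V X Y) ->
  (forall e, 0 < e < e0 -> forall v, 0 < P v 0 ->
     col v (cond_law (p e) X V) = Q + e *: K v) ->
  (forall e, 0 < e < e0 -> cond_law (p e) Y X = W) ->
  (fun e => mutual_info (p e) V Y) =
  (fun e => e ^+ 2 / 2 * \sum_v P v 0 *
     enorm (dtm W Q *m (invmx (sqrt_diag Q) *m K v)) ^+ 2)
    +o_ (0^'+) (fun e : R => e ^+ 2).
Proof.
move=> e0_gt0 hP Q0 WQ0 hW K0 PK lawV hp hM condX condY.
under eq_bigr => v _ do rewrite dtm_mul// enorm_invmx_sqrt_diag//.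
apply: (@mutual_info_perturbation R Om l n p V Y P (W *m Q)
  (fun v => W *m K v) e0) => //.
(* The columns of [W] sum to 1, so [W] preserves the total mass 0 of [K v]. *)
- move=> v; under eq_bigr do rewrite mxE.
  rewrite exchange_big -[RHS](K0 v); apply: eq_bigr => x _ /=.
  rewrite -mulr_suml -[RHS]mul1r; congr (_ * _).
  by rewrite -(hW x).2; apply: eq_bigr => y _; rewrite mxE.
- by under eq_bigr do rewrite scalemxAr; rewrite -mulmx_sumr PK mulmx0.
- move=> e e_in v Pv0; have [p0 _] := hp e e_in.
  rewrite (cond_law_markov p0 v (hM e e_in)) condX// condY//.
  by rewrite mulmxDr scalemxAr.
Qed.

Theorem lemma1 (R : realType) (nU nX nY nZ : nat)
  (PU : 'cV[R]_nU) (PX : 'cV[R]_nX)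
  (WY : 'M[R]_(nY, nX)) (WZ : 'M[R]_(nZ, nX))
  (J : 'I_nU -> 'cV[R]_nX)
  (Om : finType) (U : Om -> 'I_nU) (X : Om -> 'I_nX)
  (Y : Om -> 'I_nY) (Z : Om -> 'I_nZ)
  (e0 : R) (p : R -> Om -> R)
  (hPU : is_dist PU)
  (hPX : is_dist PX) (hPX0 : positive_entries PX)
  (hWY : column_stochastic WY) (hPY0 : positive_entries (WY *m PX))
  (hWZ : column_stochastic WZ) (hPZ0 : positive_entries (WZ *m PX))
  (hJ : forall u, \sum_x J u x 0 = 0)
  (hUJ : \sum_u PU u 0 *: J u = 0)
  (he0 : 0 < e0)
  (hpos : forall e, 0 < e < e0 -> forall u, positive_entries (PX + e *: J u))
  (hregion : forall e, 0 < e < e0 -> forall u,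
     eps_region e PX (PX + e *: J u))
  (hp : forall e, 0 < e < e0 -> is_pmf (p e))
  (hmarkov : forall e, 0 < e < e0 ->
     markov_chain (p e) U X (fun w => (Y w, Z w)))
  (hU : forall e, 0 < e < e0 -> law (p e) U = PU)
  (hXU : forall e, 0 < e < e0 -> forall u, 0 < PU u 0 ->
     col u (cond_law (p e) X U) = PX + e *: J u)
  (hYX : forall e, 0 < e < e0 -> cond_law (p e) Y X = WY)
  (hZX : forall e, 0 < e < e0 -> cond_law (p e) Z X = WZ) :
  let L u := invmx (sqrt_diag PX) *m J u in
  [/\ (fun e : R => mutual_info (p e) U X) =
        (fun e : R => e ^+ 2 / 2 * \sum_u PU u 0 * enorm (L u) ^+ 2)
        +o_ (0^'+) (fun e : R => e ^+ 2),
      (fun e : R => mutual_info (p e) U Y) =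
        (fun e : R => e ^+ 2 / 2 *
           \sum_u PU u 0 * enorm (dtm WY PX *m L u) ^+ 2)
        +o_ (0^'+) (fun e : R => e ^+ 2)
    & (fun e : R => mutual_info (p e) U Z) =
        (fun e : R => e ^+ 2 / 2 *
           \sum_u PU u 0 * enorm (dtm WZ PX *m L u) ^+ 2)
        +o_ (0^'+) (fun e : R => e ^+ 2)].
Proof.
split.
- under eq_bigr => u _ do rewrite enorm_invmx_sqrt_diag//.
  exact: mutual_info_perturbation hU hp hXU.
- apply: mutual_info_perturbation_channel he0 _ _ _ _ _ _ hU hp _ hXU hYX => //.
  (* Projecting the pair [(Y w, Z w)] to its first component gives the chain from [U] through [X] to
     [Y]. *)
  by move=> e /hmarkov /(@markov_chain_comp _ _ _ _ _ _ _ _ _ _ fst).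
- apply: mutual_info_perturbation_channel he0 _ _ _ _ _ _ hU hp _ hXU hZX => //.
  by move=> e /hmarkov /(@markov_chain_comp _ _ _ _ _ _ _ _ _ _ snd).
Qed.
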